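(* Let $K \subsetneq L$ be a field extension, and let $A$ and $B$ be two $n$-dimensional $K$-subspaces of $L$, with $n > 0$. Then the pair $(A,B)$ is unmatchable if and only if there exists a nonzero $K$-subspace $R$ of $B$ such that $A$ and $B$ can be written as (internal) direct sums of $K$-subspaces $$A = S \oplus Y, \qquad B = R \oplus Z,$$ where $\dim_K Y < \dim_K R$ and $$S = \bigoplus_{i=1}^m a_i K(R)$$ for some $a_1,\ldots,a_m \in S$. Here, $m = \dim_{K(R)} S = (\dim_K S)/[K(R):K]$.
   Context: Let $K\subsetneq L$ be a field extension and let $A,B$ be $n$-dimensional $K$-subspaces of $L$ with $n>0$. For a subset $X$ of $L$, $\langle X\rangle$ denotes the $K$-subspace of $L$ spanned by $X$. An ordered basis $\{a_1,\ldots,a_n\}$ of $A$ is matched to an ordered basis $\{b_1,\ldots,b_n\}$ of $B$ if, for each $i\in\{1,\ldots,n\}$, $a_i^{-1}A\cap B\subseteq \langle b_1,\ldots,b_{i-1},b_{i+1},\ldots,b_n\rangle$. The subspace $A$ is matched to $B$ (equivalently, the pair $(A,B)$ is matchable) if every ordered basis of $A$ can be matched to some ordered basis of $B$; otherwise $(A,B)$ is unmatchable. For a subset $R\subseteq L$, $K(R)$ denotes the smallest subfield of $L$ containing $K\cup R$, and for an intermediate field $F$ of $K\subseteq L$, $[F:K]$ denotes the $K$-dimension of $F$. *)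

(* Defs.v *)
From HB Require Import structures.
From mathcomp Require Import all_boot all_order all_algebra.
From mathcomp Require Import boolp classical_sets.

Set Implicit Arguments.
Unset Strict Implicit.
Unset Printing Implicit Defensive.

Import GRing.Theory.
Local Open Scope classical_set_scope.
Local Open Scope ring_scope.

(* L need not be finite dimensional over K, so [fieldExtType] and [{vspace _}]
   do not apply: subfields and subspaces of L are classical subsets of L. The
   field F of scalars is explicit because both K and K(R) play that role. *)

Definition is_subfield (L : fieldType) (F : set L) : Prop :=
  GRing.divring_closed [in F].

Definition is_subspace (L : fieldType) (F V : set L) : Prop :=
  V 0 /\ forall c u v, F c -> V u -> V v -> V (c * u + v).

Definition span (L : fieldType) (F X : set L) : set L :=
  smallest (is_subspace F) X.

Definition adjoin (L : fieldType) (K R : set L) : set L :=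
  smallest (@is_subfield L) (K `|` R).

Definition lin_indep (L : fieldType) (F : set L) (d : nat) (b : 'I_d -> L) :
    Prop :=
  forall c : 'I_d -> L, (forall i, F (c i)) ->
    \sum_i c i * b i = 0 -> forall i, c i = 0.

Definition is_basis (L : fieldType) (F V : set L) (d : nat) (b : 'I_d -> L) :
    Prop :=
  lin_indep F b /\ span F (range b) = V.

Definition has_dim (L : fieldType) (F V : set L) (d : nat) : Prop :=
  exists b : 'I_d -> L, is_basis F V b.

Definition scale_set (L : fieldType) (a : L) (V : set L) : set L :=
  [set a * x | x in V].

Definition is_direct_sum2 (L : fieldType) (V U W : set L) : Prop :=
  V = [set u + w | u in U & w in W] /\ U `&` W = [set 0].

(* Directness is stated as independence of the summands: 0 has only the
   trivial decomposition. *)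
Definition is_direct_sum (L : fieldType) (V : set L) (m : nat)
    (W : 'I_m -> set L) : Prop :=
  V = [set \sum_i x i | x in [set x : 'I_m -> L | forall i, W i (x i)]] /\
  forall x : 'I_m -> L, (forall i, W i (x i)) ->
    \sum_i x i = 0 -> forall i, x i = 0.

Definition basis_matched (L : fieldType) (K A B : set L) (n : nat)
    (a b : 'I_n -> L) : Prop :=
  forall i, scale_set (a i)^-1 A `&` B `<=`
    span K [set b j | j in [set j | j != i]].

Definition matchable (L : fieldType) (K A B : set L) (n : nat) : Prop :=
  forall a : 'I_n -> L, is_basis K A a ->
    exists b : 'I_n -> L, is_basis K B b /\ basis_matched K A B a b.

(* Main.v *)
Require Import Defs.
From HB Require Import structures.
From mathcomp Require Import all_boot all_order all_algebra zify.
From mathcomp Require Import boolp classical_sets.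

Set Implicit Arguments.
Unset Strict Implicit.
Unset Printing Implicit Defensive.

Import GRing.Theory.
Local Open Scope classical_set_scope.
Local Open Scope ring_scope.

(* For an ordered basis a of A put E_i = a_i^-1 A :&: B. By Rado's theorem, applied
   to subspaces instead of sets, a can be matched unless some J satisfies
   dim (\bigcap_(i in J) E_i) + #|J| > n. In that case X = <a_i : i in J> and
   R = \bigcap_(i in J) E_i satisfy XR <= A and dim X + dim R > dim A. Dyson's
   e-transform enlarges X and shrinks R until XR <= X; then X is a module over
   its stabilizer, a field containing K(R), and S = X works.
   Conversely, if SR <= S, complete a basis of S to a basis of A: in a basis b of
   B matched to it the coordinates of R along the first dim S vectors vanish, so
   dim R <= n - dim S = dim Y. *)

(** * Rado's theorem for subspaces of a finite-dimensional space *)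

Section Rado.
Variables (F : fieldType) (vT : vectType F) (n : nat).
Hypothesis dim_vT : \dim {:vT} = n.
Implicit Types (E : 'I_n -> {vspace vT}) (H : {vspace vT}) (J : {set 'I_n}).

Let capE E J : {vspace vT} := (\bigcap_(i in J) E i)%VS.

(** Dually, the annihilators of the [E i] satisfy Rado's condition: those indexed by [J] together
    span at least [#|J|] dimensions. Independent functionals, one from each annihilator, have the
    family [b] of [rado_transversal] as dual basis. *)
Definition rado E : bool := [forall J, \dim (capE E J) + #|J| <= n]%N.

(** Intersecting with a subspace of codimension at most one costs at most one dimension. *)
Lemma dim_capv_hyperplanes E (s : seq 'I_n) :
  (forall i, n <= (\dim (E i)).+1)%N ->
  (n <= \dim (\bigcap_(i <- s) E i)%VS + size s)%N.
Proof.
move=> hE; elim: s => [|i s IHs]; first by rewrite big_nil dim_vT leq_addr.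
rewrite big_cons /= addnS.
have := dimv_sum_cap (E i) (\bigcap_(j <- s) E j)%VS.
have := dimvS (subvf (E i + \bigcap_(j <- s) E j)%VS); rewrite dim_vT.
by move: (hE i) IHs => /=; lia.
Qed.

(** Take [b i] nonzero in all the [E j] with [j != i]. It avoids [E i], because the condition for
    the full index set makes the intersection of the whole family zero. Modulo [E i], a combination
    of the [b j] thus reduces to its [i]-th term. *)
Lemma rado_hyperplanes E : rado E -> (forall i, n <= (\dim (E i)).+1)%N ->
  exists b : 'I_n -> vT, forall (c : 'I_n -> F) i,
    \sum_j c j *: b j \in E i -> c i = 0.
Proof.
move=> /forallP rE hE.
pose W i := capE E [set~ i]%SET.
have subW i j : j != i -> (W i <= E j)%VS.
  by move=> ji; apply: bigcapv_inf (subvv _); rewrite !inE.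
have W_neq0 i : W i != 0%VS.
  rewrite -dimv_eq0 -lt0n.
  (* The intersection of [n - 1] members has dimension at least 1. *)
  have := dim_capv_hyperplanes (enum [set~ i]%SET) hE.
  rewrite big_enum_cond /= (eq_bigl (mem [set~ i]%SET)); last by move=> j; rewrite andbT.
  rewrite -cardE cardsC1 card_ord.
  have n_gt0 := leq_ltn_trans (leq0n i) (ltn_ord i).
  by rewrite -[X in (X <= _)%N](prednK n_gt0) -add1n leq_add2r.
pose b i := vpick (W i).
have bE i j : j != i -> b i \in E j.
  by move=> ji; apply: subvP (subW _ _ ji) _ (memv_pick _).
have bnE i : b i \notin E i.
  apply/negP => bi.
  have : b i \in capE E [set: 'I_n]%SET.
    rewrite /capE memvE; apply/subv_bigcapP => j _; rewrite -memvE.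
    by have [->//|] := eqVneq j i; apply: bE.
  have := rE [set: 'I_n]%SET; rewrite cardsT card_ord -[X in (_ <= X)%N]add0n leq_add2r.
  rewrite leqn0 dimv_eq0 => /eqP->; rewrite memv0 vpick0; apply/negP/W_neq0.
exists b => c i cE; apply/eqP; apply: contraNT (bnE i) => ci.
have : c i *: b i \in E i.
  have h : \sum_(j < n | j != i) c j *: b j \in E i.
    by apply: memv_suml => j ji; apply/memvZ/bE; rewrite eq_sym.
  by move: cE; rewrite (bigD1 i) //= => /memvB/(_ h); rewrite addrK.
by move/(memvZ (c i)^-1); rewrite scalerA mulVf // scale1r.
Qed.

Definition replace E i0 H : 'I_n -> {vspace vT} := fun i => if i == i0 then H else E i.

(** A set violating the condition must contain [i0], since no other member has changed; deleting
    [i0] from it turns the strict inequality into a weak one. *)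
Lemma rado_replace E i0 H : rado E -> ~~ rado (replace E i0 H) ->
  exists2 J : {set 'I_n}, i0 \notin J & (n <= \dim (H :&: capE E J)%VS + #|J|)%N.
Proof.
move=> /forallP rE /forallPn[J]; rewrite -ltnNge => ltJ.
have [i0J|i0J] := boolP (i0 \in J); last first.
  move: ltJ; rewrite /replace /capE (eq_bigr E) ?ltnNge ?rE // => i iJ.
  by case: eqP => // eqi; rewrite -eqi iJ in i0J.
exists (J :\ i0)%SET; first by rewrite !inE eqxx.
move: ltJ; rewrite /replace /capE (bigD1 i0) //= eqxx (cardsD1 i0) i0J addnCA add1n ltnS.
rewrite (eq_bigl (fun i => i \in (J :\ i0)%SET)); last first.
  by move=> i; rewrite in_setD1 andbC.
rewrite [X in (_ :&: X)%VS](eq_bigr E) // => i.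
by rewrite in_setD1 => /andP[/negPf->].
Qed.

Lemma exists_add_vline (U : {vspace vT}) : (\dim U < n)%N ->
  exists x, \dim (U + <[x]>)%VS = (\dim U).+1.
Proof.
move=> ltU; have [x xU] : exists x, x \notin U.
  apply/not_existsP => allU; move: ltU; rewrite -dim_vT ltnNge dimvS //.
  by apply/subvP => x _; apply/negPn/negP/allU.
exists x; rewrite dimv_disjoint_sum ?dim_vline ?addn1; last first.
  apply/eqP; rewrite -subv0; apply/subvP => y /memv_capP[yU /vlineP[k yk]].
  rewrite memv0 yk; have [->|k0] := eqVneq k 0; first by rewrite scale0r.
  by case/negP: xU; rewrite -[x]scale1r -(mulVf k0) -scalerA -yk memvZ.
by case: eqP xU => [->|_ _]; rewrite ?mem0v ?addn1.
Qed.

(* Submodularity of dimension: a subspace of codimension at least 2 is the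
   intersection of two larger ones, and one of them can replace it. *)
Lemma rado_enlarge E i0 : rado E -> ((\dim (E i0)).+1 < n)%N ->
  exists H : {vspace vT}, [/\ rado (replace E i0 H), (E i0 <= H)%VS &
                (\dim (E i0) < \dim H)%N].
Proof.
move=> rE lt2.
have [x dx] := exists_add_vline (ltnW lt2).
have [|y dy] := @exists_add_vline (E i0 + <[x]>)%VS; first by rewrite dx.
(* Since [y] is outside [H], the spaces [H] and [H'] will meet exactly in [E i0]. *)
set H := (E i0 + <[x]>)%VS in dx dy *; pose H' := (E i0 + <[y]>)%VS.
have dHH' : (H + H' = H + <[y]>)%VS.
  by rewrite /H' addvA (addv_idPl (addvSl _ _)).
have dH' : \dim H' = (\dim (E i0)).+1.
  apply/eqP; rewrite eqn_leq; apply/andP; split.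
    rewrite /H' (leq_trans (dimv_add_leqif _ _)) // dim_vline -addn1 leq_add2l.
    by case: eqP.
  have := dimv_sum_cap H H'; rewrite dHH' dy dx => h.
  have : (\dim (E i0) <= \dim (H :&: H'))%N.
    by rewrite dimvS // subv_cap !addvSl.
  by lia.
have dI : (H :&: H' = E i0)%VS.
  apply/esym/eqP; rewrite eqEdim subv_cap !addvSl /=.
  have /eqP := dimv_sum_cap H H'; rewrite dHH' dy dx dH'.
  by rewrite !addSn !addnS !eqSS eqn_add2l => /eqP->.
have [rH|/rado_replace-/(_ rE)[J i0J hJ]] := boolP (rado (replace E i0 H)).
  by exists H; split=> //; rewrite ?dx ?addvSl.
exists H'; split; rewrite ?dH' ?addvSl //.
apply: contraT => /rado_replace-/(_ rE)[J' i0J' hJ'].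
(* If both replacements fail, [hJ] and [hJ'] add up to at least [2n]. By submodularity the same
   total is bounded by the conditions for [J :&: J'] and [i0 |: (J :|: J')]; as [i0] is in neither
   [J] nor [J'], it is counted once more there, so the total is below [2n]. *)
have := leq_add hJ hJ'; rewrite leqNgt => /negP[].
have := dimv_sum_cap (H :&: capE E J) (H' :&: capE E J').
set X := (_ + _)%VS; set Y := (_ :&: _)%VS => XY.
have hX : (X <= capE E (J :&: J'))%VS.
  apply/subv_bigcapP => i; rewrite inE => /andP[iJ iJ'].
  rewrite subv_add (subv_trans (capvSr _ _)) ?(bigcapv_inf i) //.
  by rewrite (subv_trans (capvSr _ _)) ?(bigcapv_inf i).
have hY : (Y <= capE E (i0 |: (J :|: J')))%VS.
  apply/subv_bigcapP => i; rewrite !inE => /or3P[/eqP->|iJ|iJ'].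
  - by rewrite -dI capvS ?capvSl.
  - by rewrite (subv_trans (capvSl _ _)) // (subv_trans (capvSr _ _)) ?(bigcapv_inf i).
  - by rewrite (subv_trans (capvSr _ _)) // (subv_trans (capvSr _ _)) ?(bigcapv_inf i).
have cJ : (#|J :&: J'| + #|i0 |: (J :|: J')| = (#|J| + #|J'|).+1)%N.
  by rewrite cardsU1 inE (negPf i0J) (negPf i0J') add1n addnS addnC cardsUI.
move/forallP: rE => rE.
have := leq_add (rE (J :&: J')%SET) (rE (i0 |: (J :|: J'))%SET).
by rewrite [in X in X -> _]addnACA cJ addnS => hn; apply: leq_trans hn;
  rewrite addnACA -XY ltnS leq_add2r leq_add // dimvS.
Qed.

(** Induction on the total codimension: members of codimension at least 2 are enlarged until
    [rado_hyperplanes] applies. A family [b] that works for larger subspaces works for the original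
    ones. *)
Lemma rado_transversal E : rado E ->
  exists b : 'I_n -> vT, forall (c : 'I_n -> F) i,
    \sum_j c j *: b j \in E i -> c i = 0.
Proof.
have [k] := ubnP (\sum_i (n - \dim (E i)))%N.
elim: k E => // k IHk E; rewrite ltnS => leE rE.
have [/forallP hE|/forallPn[i0]] := boolP [forall i, n <= (\dim (E i)).+1]%N.
  exact: rado_hyperplanes.
rewrite -ltnNge => lt2.
have [H [rH subH ltH]] := rado_enlarge rE lt2.
have [|b hb] := IHk _ _ rH.
  rewrite /replace; apply: leq_trans leE; rewrite (bigD1 i0) //= [X in (_ < X)%N](bigD1 i0) //=.
  rewrite eqxx -addSn leq_add //.
    by rewrite ltn_sub2l // (leq_trans (leqnSn _) lt2).
  by rewrite leq_sum // => i /negPf->.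
exists b => c i h; apply: hb; rewrite /replace.
have [i_eq|//] := eqVneq i i0; rewrite i_eq in h.
exact: subvP subH _ h.
Qed.
End Rado.

(** * From subfields and subspaces given as sets to field types and [vspace] *)

Section SubfieldType.
Variables (L : fieldType) (S : divringClosed L).

Record subfield_type := SubfieldType {subfield_val : L; _ : subfield_val \in S}.

HB.instance Definition _ := [isSub for subfield_val].
HB.instance Definition _ := [Choice of subfield_type by <:].
HB.instance Definition _ := [SubChoice_isSubComUnitRing of subfield_type by <:].
HB.instance Definition _ := [SubComUnitRing_isSubIntegralDomain of subfield_type by <:].
HB.instance Definition _ := [SubIntegralDomain_isSubField of subfield_type by <:].
End SubfieldType.

(** Gives the scalars a type, so that vector space theory over [F] becomes available. It serves both
    for [K] and for [adjoin K R]. *)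
Lemma subfield_range (L : fieldType) (K : set L) : is_subfield K ->
  exists (F : fieldType) (iota : {rmorphism F -> L}), K = range iota.
Proof.
move=> sK; pose m := GRing.isDivringClosed.Build L [in K] sK.
pose S : divringClosed L := HB.pack_for (divringClosed L) ([in K] : {pred L}) m.
exists (subfield_type S), (val : {rmorphism subfield_type S -> L}).
apply/seteqP; split=> [x Kx|_ [[x /= Kx] _ <-]]; last exact: set_mem Kx.
by exists (SubfieldType (mem_set Kx : x \in S)).
Qed.

(** Among the subspaces contained in [P] take one of maximal dimension: adjoining a vector of [P]
    stays within [P], so it cannot enlarge it. *)
Lemma vspace_of_pred (F : fieldType) (vT : vectType F) (P : set vT) :
  P 0 -> (forall c u v, P u -> P v -> P (c *: u + v)) ->
  exists U : {vspace vT}, forall v, v \in U <-> P v.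
Proof.
move=> P0 Plin.
pose D d := `[< exists U : {vspace vT}, (forall v, v \in U -> P v) /\ \dim U = d >].
have exD : exists d, D d.
  exists 0%N; apply/asboolP; exists 0%VS; split=> [v|]; last exact: dimv0.
  by rewrite memv0 => /eqP->.
have ubD d : D d -> (d <= \dim {:vT})%N.
  by move=> /asboolP[U [_ <-]]; rewrite dimvS ?subvf.
have [d /asboolP[U [UP dU]] maxd] := ex_maxnP exD ubD.
exists U => v; split=> [/UP//|Pv].
suff /maxd : D (\dim (U + <[v]>)%VS).
  rewrite -dU => le; have := dimv_leqif_sup (addvSl U <[v]>).
  move/geq_leqif; rewrite le => /esym; rewrite subv_add => /andP[_].
  by rewrite memvE.
apply/asboolP; exists (U + <[v]>)%VS; split=> // _ /memv_addP[u uU [_ /vlineP[c ->] ->]].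
by rewrite addrC; apply: Plin => //; apply: UP.
Qed.

(** * Linear algebra in [L] over [K], through coordinates *)

Section Combinations.
Variables (F L : fieldType) (iota : {rmorphism F -> L}).
Local Notation K := (range iota).

(* The subfield K of L is the image of an abstract field F, so that row vectors
   over F provide coordinates. *)
Definition comb n (w : 'I_n -> L) (v : 'rV[F]_n) : L := \sum_i iota (v 0 i) * w i.

Lemma combP n (w : 'I_n -> L) c u v :
  comb w (c *: u + v) = iota c * comb w u + comb w v.
Proof.
rewrite /comb mulr_sumr -big_split /=; apply: eq_bigr => i _.
by rewrite !mxE rmorphD rmorphM mulrDl mulrA.
Qed.

Lemma comb0 n (w : 'I_n -> L) : comb w 0 = 0.
Proof. by rewrite /comb big1 // => i _; rewrite mxE rmorph0 mul0r. Qed.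

Lemma combD n (w : 'I_n -> L) u v : comb w (u + v) = comb w u + comb w v.
Proof. by rewrite -[u in LHS]scale1r combP rmorph1 mul1r. Qed.

Lemma combZ n (w : 'I_n -> L) c u : comb w (c *: u) = iota c * comb w u.
Proof. by rewrite -[in LHS](addr0 (c *: u)) combP comb0 addr0. Qed.

Lemma combB n (w : 'I_n -> L) u v : comb w (u - v) = comb w u - comb w v.
Proof. by rewrite -scaleN1r combD combZ rmorphN1 mulN1r. Qed.

Lemma comb_sum n (w : 'I_n -> L) m (u : 'I_m -> 'rV_n) :
  comb w (\sum_j u j) = \sum_j comb w (u j).
Proof. exact: (big_morph _ (combD w) (comb0 w)). Qed.

Lemma comb_delta n (w : 'I_n -> L) i : comb w (delta_mx 0 i) = w i.
Proof.
rewrite /comb (bigD1 i) //= big1 ?addr0 => [|j ji]; rewrite mxE eqxx /=.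
  by rewrite eqxx rmorph1 mul1r.
by rewrite (negPf ji) rmorph0 mul0r.
Qed.

Lemma comb_comb n (w : 'I_n -> L) m (u : 'I_m -> 'rV_n) v :
  comb (comb w \o u) v = comb w (\sum_j v 0 j *: u j).
Proof. by rewrite comb_sum; apply: eq_bigr => j _; rewrite combZ. Qed.

Lemma comb_ext n (w w' : 'I_n -> L) : w =1 w' -> comb w =1 comb w'.
Proof. by move=> ww' v; apply: eq_bigr => i _; rewrite ww'. Qed.

Lemma lin_indepP n (w : 'I_n -> L) :
  lin_indep K w <-> forall v, comb w v = 0 -> v = 0.
Proof.
split=> [wi v v0|wi c cK c0 i].
  apply/rowP => i; rewrite mxE; apply: (fmorph_inj iota); rewrite rmorph0.
  by apply: (wi (fun i => iota (v 0 i))) => // j; exists (v 0 j).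
have /choice[d dc] : forall i, exists d, iota d = c i.
  by move=> j; have [d _ <-] := cK j; exists d.
have := wi (\row_j d j); rewrite /comb (eq_bigr (fun i => c i * w i)) => [/(_ c0)|j _].
  by move/rowP/(_ i); rewrite !mxE -dc => ->; rewrite rmorph0.
by rewrite mxE dc.
Qed.

Lemma comb_inj n (w : 'I_n -> L) :
  (forall v, comb w v = 0 -> v = 0) <-> injective (comb w).
Proof.
split=> [wi u v uv|wi v]; last by rewrite -(comb0 w) => /wi.
by apply/eqP; rewrite -subr_eq0; apply/eqP/wi; rewrite combB uv subrr.
Qed.

Lemma lin_indep_neq0 n (w : 'I_n -> L) i : lin_indep K w -> w i != 0.
Proof.
move=> /lin_indepP wi; apply/eqP => w0.
have /rowP/(_ i) : delta_mx 0 i = 0 :> 'rV[F]_n by apply: wi; rewrite comb_delta.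
by rewrite !mxE !eqxx => /eqP; rewrite oner_eq0.
Qed.

Lemma subspaceD V u v : is_subspace K V -> V u -> V v -> V (u + v).
Proof.
by move=> [_ h] Vu Vv; rewrite -[u]mul1r; apply: h => //; exists 1 => //; rewrite rmorph1.
Qed.

Lemma subspaceZ V c v : is_subspace K V -> V v -> V (iota c * v).
Proof. by move=> [V0 h] Vv; rewrite -[X in V X]addr0; apply: h => //; exists c. Qed.

Lemma subspaceB V u v : is_subspace K V -> V u -> V v -> V (u - v).
Proof.
move=> sV Vu Vv; apply: subspaceD => //; rewrite -mulN1r -(rmorphN1 iota).
exact: subspaceZ.
Qed.

Lemma subspace_sum V (I : Type) (r : seq I) (P : pred I) (f : I -> L) :
  is_subspace K V -> (forall i, P i -> V (f i)) -> V (\sum_(i <- r | P i) f i).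
Proof.
move=> sV Vf; elim/big_ind : _ => //; first by case: sV.
by move=> x y; apply: subspaceD.
Qed.

Lemma subspace_comb V n (w : 'I_n -> L) v :
  is_subspace K V -> (forall i, V (w i)) -> V (comb w v).
Proof. by move=> sV Vw; apply: subspace_sum => // i _; apply: subspaceZ. Qed.

Lemma subspace_span X : is_subspace K (Defs.span K X).
Proof.
split=> [V [[]]//|c u v Kc Vu Vv V VX].
by have [[_ h] _] := VX; apply: h => //; [apply: Vu|apply: Vv].
Qed.

Lemma sub_span X : X `<=` Defs.span K X.
Proof. by move=> x Xx V [_]; apply. Qed.

Lemma span_sub X V : is_subspace K V -> X `<=` V -> Defs.span K X `<=` V.
Proof. by move=> sV XV x; apply. Qed.

Lemma comb_span n (w : 'I_n -> L) (D : set 'I_n) (v : 'rV[F]_n) :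
  (forall i, v 0 i != 0 -> D i) -> Defs.span K [set w i | i in D] (comb w v).
Proof.
move=> vD; apply: subspace_sum => [|i _]; first exact: subspace_span.
have [->|/vD Di] := eqVneq (v 0 i) 0.
  by rewrite rmorph0 mul0r; case: (subspace_span [set w i | i in D]).
by apply: (subspaceZ _ (subspace_span _)); apply: sub_span; exists i.
Qed.

Lemma subspace_image n (w : 'I_n -> L) (U : {vspace 'rV[F]_n}) :
  is_subspace K (comb w @` [set` U]).
Proof.
split=> [|_ _ _ [c _ <-] [u uU <-] [v vU <-]].
  by exists 0; rewrite ?comb0 //= mem0v.
by exists (c *: u + v); rewrite ?combP //=; apply: memvD => //; apply: memvZ.
Qed.

Lemma subspace_range n (w : 'I_n -> L) : is_subspace K (range (comb w)).
Proof.
have -> : range (comb w) = comb w @` [set` fullv].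
  by congr (_ @` _); apply/seteqP; split=> x //= _; apply: memvf.
exact: subspace_image.
Qed.

Lemma span_range n (w : 'I_n -> L) : Defs.span K (range w) = range (comb w).
Proof.
apply/seteqP; split.
  apply: span_sub (subspace_range w) _ => _ [i _ <-].
  by exists (delta_mx 0 i) => //; apply: comb_delta.
move=> _ [v _ <-]; apply: subspace_comb; first exact: subspace_span.
by move=> i; apply: sub_span; exists i.
Qed.

Lemma is_basisP V n (w : 'I_n -> L) :
  is_basis K V w <-> injective (comb w) /\ range (comb w) = V.
Proof.
rewrite /is_basis span_range; split=> -[wi wV]; split=> //.
  exact/comb_inj/lin_indepP.
exact/lin_indepP/comb_inj.
Qed.

(** Injectivity is asked on [U] only, because [has_dim_span] applies this to a possibly dependent
    [w], with [U] a complement of the kernel. *)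
Lemma has_dim_image n (w : 'I_n -> L) (U : {vspace 'rV[F]_n}) :
  {in U &, injective (comb w)} -> has_dim K (comb w @` [set` U]) (\dim U).
Proof.
move=> winj; exists (comb w \o (fun i : 'I_(\dim U) => (vbasis U)`_i)); apply/is_basisP.
have bU (v : 'rV[F]_(\dim U)) : \sum_j v 0 j *: (vbasis U)`_j \in U.
  by apply: memv_suml => j _; apply/memvZ/vbasis_mem/memt_nth.
split=> [u v|].
  rewrite !comb_comb => /(winj _ _ (bU _) (bU _))/eqP.
  rewrite -subr_eq0 -sumrB => /eqP uv; apply/rowP => i.
  apply/eqP; rewrite -subr_eq0; apply/eqP.
  move/freeP: (basis_free (vbasisP U)) => /(_ (fun i => u 0 i - v 0 i)); apply.
  by rewrite -[RHS]uv; apply: eq_bigr => j _; rewrite scalerBl.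
apply/seteqP; split=> [_ [v _ <-]|_ [u /= uU <-]].
  by rewrite comb_comb; exists (\sum_j v 0 j *: (vbasis U)`_j) => //; apply: bU.
exists (\row_i coord (vbasis U) i u) => //; rewrite comb_comb.
rewrite [in RHS](coord_vbasis uU); congr comb.
by apply: eq_bigr => i _; rewrite mxE.
Qed.

Lemma has_dim_inj_image n (w : 'I_n -> L) (U : {vspace 'rV[F]_n}) :
  injective (comb w) -> has_dim K (comb w @` [set` U]) (\dim U).
Proof. by move=> wi; apply: has_dim_image => u v _ _ /wi. Qed.

Lemma subspace_preimage n (w : 'I_n -> L) V : is_subspace K V ->
  exists U : {vspace 'rV[F]_n}, forall v, v \in U <-> V (comb w v).
Proof.
move=> sV; apply: (vspace_of_pred (P := fun v => V (comb w v))).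
  by rewrite comb0; case: sV.
by move=> c u v Vu Vv; rewrite combP; case: sV => _; apply=> //; exists c.
Qed.

Lemma subspace_coord n (w : 'I_n -> L) V :
  is_subspace K V -> V `<=` range (comb w) ->
  exists U : {vspace 'rV[F]_n}, V = comb w @` [set` U].
Proof.
move=> /subspace_preimage-/(_ _ w)[U UV] VW; exists U; apply/seteqP; split.
  by move=> x Vx; have [v _ vx] := VW _ Vx; exists v => //=; apply/UV; rewrite vx.
by move=> _ [v /UV Vv <-].
Qed.

(** With [U] the kernel of [comb w], a complement of [U] is mapped bijectively onto the span. *)
Lemma has_dim_span n (w : 'I_n -> L) : exists d, has_dim K (Defs.span K (range w)) d.
Proof.
have s0 : is_subspace K [set 0].
  by split=> // c _ _ _ -> ->; rewrite mulr0 addr0.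
have [U UV] := subspace_preimage w s0.
exists (\dim (U^C)); rewrite span_range.
have -> : range (comb w) = comb w @` [set` (U^C)%VS].
  apply/seteqP; split=> [_ [v _ <-]|_ [v _ <-]]; last by exists v.
  have : v \in (U + U^C)%VS by rewrite addv_complf memvf.
  move=> /memv_addP[u /UV /= u0 [u' u'U ->]]; exists u' => //.
  by rewrite combD u0 add0r.
apply: has_dim_image => u v uU vU uv; apply/eqP; rewrite -subr_eq0 -memv0.
by rewrite -(capv_compl U) memv_cap (memvB uU vU) andbT; apply/UV; rewrite combB uv subrr.
Qed.

(** Coordinate vectors chosen for the [x i] are free in ['rV_n]. *)
Lemma lin_indep_leq n (w : 'I_n -> L) m (x : 'I_m -> L) :
  lin_indep K x -> (forall i, range (comb w) (x i)) -> (m <= n)%N.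
Proof.
move=> /lin_indepP xi xw.
have /choice[u ux] : forall i, exists u, comb w u = x i.
  by move=> i; have [u _ <-] := xw i; exists u.
have fu : free [tuple u i | i < m].
  apply/freeP => k; under eq_bigr do rewrite -tnth_nth tnth_mktuple.
  move=> k0 i; suff /rowP/(_ i) : \row_i k i = 0 by rewrite !mxE.
  apply: xi; rewrite -(comb_ext ux) comb_comb -[RHS](comb0 w) -[in RHS]k0; congr comb.
  by apply: eq_bigr => j _; rewrite mxE.
move: fu; rewrite /free size_tuple => /eqP <-.
by rewrite (leq_trans (dimvS (subvf _))) // dimvf /dim /= mul1n.
Qed.

Lemma has_dim_leq V W m n : has_dim K V m -> has_dim K W n -> V `<=` W -> (m <= n)%N.
Proof.
move=> [x [xi xV]] [w /is_basisP[_ wW]] VW; apply: (lin_indep_leq (w := w) xi) => i.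
by rewrite wW; apply: VW; rewrite -xV; apply: sub_span; exists i.
Qed.

Lemma has_dim_uniq V m n : has_dim K V m -> has_dim K V n -> m = n.
Proof.
move=> Vm Vn; apply/eqP; rewrite eqn_leq.
by rewrite (has_dim_leq Vm Vn) // (has_dim_leq Vn Vm).
Qed.

Lemma has_dim_sub V W n : has_dim K W n -> is_subspace K V -> V `<=` W ->
  exists d, has_dim K V d.
Proof.
move=> [w /is_basisP[wi wW]] sV; rewrite -wW => VW.
have [U ->] := subspace_coord sV VW.
by exists (\dim U); apply: has_dim_inj_image.
Qed.

Lemma has_dim_eq V W n : has_dim K V n -> has_dim K W n -> V `<=` W -> V = W.
Proof.
move=> Vn [w wb]; have /is_basisP[wi wW] := wb; rewrite -wW => VW.
have sV : is_subspace K V by case: Vn => v [_ <-]; apply: subspace_span.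
have [U VU] := subspace_coord sV VW.
have dU : \dim U = n.
  apply: has_dim_uniq Vn; rewrite VU; exact: has_dim_inj_image.
have -> : V = comb w @` [set` U] by [].
have /eqP-> : U == fullv by rewrite eqEdim subvf dU dimvf /dim /= mul1n.
by congr (_ @` _); apply/seteqP; split=> x //= _; apply: memvf.
Qed.

(** Grassmann's formula [dimv_sum_cap], transported through coordinates in a basis of the common
    ambient space [A]. *)
Lemma has_dim_add U V A n : has_dim K A n -> is_subspace K U -> is_subspace K V ->
  U `<=` A -> V `<=` A ->
  exists p q s t, [/\ has_dim K U p, has_dim K V q,
    has_dim K [set u + v | u in U & v in V] s, has_dim K (U `&` V) t &
    (s + t = p + q)%N].
Proof.
move=> [w /is_basisP[wi <-]] sU sV UA VA.
have [U' ->] := subspace_coord sU UA; have [V' ->] := subspace_coord sV VA.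
have dI W := has_dim_inj_image W wi.
exists (\dim U'), (\dim V'), (\dim (U' + V')%VS), (\dim (U' :&: V')%VS).
split=> //; last exact: dimv_sum_cap.
  rewrite (_ : [set _ | _ in _ & _ in _] = comb w @` [set` (U' + V')%VS]) //.
  apply/seteqP; split=> [_ [_ [u /= uU <-] [_ [v /= vV <-] <-]]|].
    by exists (u + v); rewrite ?combD //=; apply: memv_add.
  move=> _ [_ /memv_addP[u uU [v vV ->]] <-].
  by exists (comb w u); [exists u|exists (comb w v); [exists v|rewrite combD]].
rewrite (_ : _ `&` _ = comb w @` [set` (U' :&: V')%VS]) //.
apply/seteqP; split=> [_ [[u uU <-] [v vV /wi uv]]|_ [u /memv_capP[uU uV] <-]].
  by exists u => //=; rewrite memv_cap; apply/andP; split=> //; rewrite -uv.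
by split; exists u.
Qed.

Lemma is_basis_scale e V n (w : 'I_n -> L) : e != 0 -> is_basis K V w ->
  is_basis K (scale_set e V) (fun i => e * w i).
Proof.
move=> e0 /is_basisP[wi wV]; apply/is_basisP.
have cE v : comb (fun i => e * w i) v = e * comb w v.
  by rewrite /comb mulr_sumr; apply: eq_bigr => i _; rewrite mulrCA.
split=> [u v|]; first by rewrite !cE => /(mulfI e0)/wi.
by rewrite -wV /scale_set image_comp; congr (_ @` _); apply/funext.
Qed.

End Combinations.

(** * Generated subfields *)

Lemma is_subfieldP (L : fieldType) (P : set L) :
  P 1 -> (forall x y, P x -> P y -> P (x - y)) ->
  (forall x y, P x -> P y -> P (x / y)) -> is_subfield P.
Proof.
by move=> P1 PB Pd; split=> [|x y|x y]; rewrite !in_setE; [|apply: PB|apply: Pd].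
Qed.

Lemma subfield_adjoin (L : fieldType) (K R : set L) : is_subfield (adjoin K R).
Proof.
apply: is_subfieldP => [M [[M1 _ _] _]|x y hx hy M [sM KM]|x y hx hy M [sM KM]].
- exact: set_mem M1.
- by have [_ MB _] := sM; apply/set_mem/MB; apply/mem_set; [apply: hx|apply: hy].
- by have [_ _ Md] := sM; apply/set_mem/Md; apply/mem_set; [apply: hx|apply: hy].
Qed.

Lemma subfieldM (L : fieldType) (E : set L) x y :
  is_subfield E -> E x -> E y -> E (x * y).
Proof.
move=> [E1 _ Ed] /mem_set Ex /mem_set Ey; apply: set_mem.
by rewrite -[y]invrK -[y^-1]mul1r !Ed.
Qed.

(** * Complements, scalings and the e-transform *)

Section Matching.
Variables (F L : fieldType) (iota : {rmorphism F -> L}).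
Local Notation K := (range iota).

Lemma complement A n V d : has_dim K A n -> is_subspace K V -> V `<=` A ->
  has_dim K V d ->
  exists W, [/\ is_subspace K W, is_direct_sum2 A V W & has_dim K W (n - d)].
Proof.
move=> [w /is_basisP[wi <-]] sV VA Vd.
have [U VU] := subspace_coord sV VA.
have dI W := has_dim_inj_image W wi.
have dU : \dim U = d by apply: has_dim_uniq Vd; rewrite VU.
exists (comb iota w @` [set` (U^C)%VS]); split; first exact: subspace_image.
  rewrite VU; split; apply/seteqP; split.
  - move=> _ [v _ <-]; have : v \in (U + U^C)%VS by rewrite addv_complf memvf.
    case/memv_addP => u uU [u' u'U ->]; exists (comb iota w u); first by exists u.
    by exists (comb iota w u'); [exists u'|rewrite combD].
  - by move=> _ [_ [u _ <-] [_ [v _ <-] <-]]; exists (u + v); rewrite ?combD.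
  - move=> _ [[u /= uU <-] [v /= vU /wi uv]]; rewrite uv in vU.
    have : u \in (U :&: U^C)%VS by rewrite memv_cap uU.
    by rewrite capv_compl memv0 => /eqP->; rewrite comb0.
  - by move=> _ ->; split; exists 0; rewrite ?comb0 //=; apply: mem0v.
by have := dI (U^C)%VS; rewrite dimv_compl dU dimvf /dim /= mul1n.
Qed.

Lemma scale_setV (e : L) (V : set L) : e != 0 -> scale_set e^-1 (scale_set e V) = V.
Proof.
move=> e0; rewrite /scale_set image_comp (_ : _ \o _ = id) ?image_id //.
by apply/funext => x /=; rewrite mulKf.
Qed.

Lemma has_dim_scale e V n : e != 0 -> has_dim K (scale_set e V) n <-> has_dim K V n.
Proof.
move=> e0; split=> [[w wV]|[w wV]].
  by eexists; rewrite -(scale_setV V e0); apply: is_basis_scale wV; rewrite invr_eq0.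
by eexists; apply: is_basis_scale wV.
Qed.

Lemma subspace_mul_preimage e V : is_subspace K V -> is_subspace K [set x | V (e * x)].
Proof.
move=> [V0 hV]; split=> [|c u v Kc Vu Vv] /=; first by rewrite mulr0.
by rewrite mulrDr mulrCA; apply: hV.
Qed.

Lemma subspaceI V W : is_subspace K V -> is_subspace K W -> is_subspace K (V `&` W).
Proof.
move=> [V0 hV] [W0 hW]; split=> // c u v Kc [? ?] [? ?].
by split; [apply: hV|apply: hW].
Qed.

Lemma subspace_scale e V : is_subspace K V -> is_subspace K (scale_set e V).
Proof.
move=> [V0 hV]; split=> [|c _ _ Kc [u Vu <-] [v Vv <-]].
  by exists 0; rewrite ?mulr0.
by exists (c * u + v); [apply: hV|rewrite mulrDr mulrCA].
Qed.

Lemma subspace_add V W : is_subspace K V -> is_subspace K W ->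
  is_subspace K [set u + v | u in V & v in W].
Proof.
move=> [V0 hV] [W0 hW]; split; first by exists 0 => //; exists 0; rewrite ?addr0.
move=> c _ _ Kc [u Vu [v Wv <-]] [u' Vu' [v' Wv' <-]].
exists (c * u + u'); first exact: hV.
by exists (c * v + v'); [apply: hW|rewrite mulrDr addrACA].
Qed.

(* Dyson's e-transform replaces (X, R) by (X + eR, R :&: e^-1 X): it preserves the
   sum of the dimensions and only stops when eR is contained in X for every e in X. *)
Lemma dyson_transform A n X R p q : has_dim K A n -> is_subspace K A ->
  is_subspace K X -> is_subspace K R -> X `<=` A ->
  (forall x r, X x -> R r -> A (x * r)) ->
  has_dim K X p -> has_dim K R q -> (n < p + q)%N ->
  exists X' R' p' q', [/\ is_subspace K X', is_subspace K R', X' `<=` A & R' `<=` R] /\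
    [/\ forall x r, X' x -> R' r -> X' (x * r), has_dim K X' p', has_dim K R' q' &
      (n < p' + q')%N].
Proof.
move=> An sA; have [k] := ubnP q; elim: k q p X R => // k IHk q p X R ltq.
move=> sX sR XA XR Xp Rq lt_n.
have [stable|] := pselect (forall x r, X x -> R r -> X (x * r)).
  by exists X, R, p, q; split; split.
case/existsNP=> e /existsNP[r /not_implyP[Xe /not_implyP[Rr nX]]].
have e0 : e != 0.
  by apply/eqP => e0; apply: nX; rewrite e0 mul0r; case: sX.
have sRe := subspace_scale e sR.
have ReA : scale_set e R `<=` A by move=> _ [s Rs <-]; apply: XR.
have [p1 [q1 [s [t [Xp1 Req1 XReS XReT st]]]]] := has_dim_add An sX sRe XA ReA.
have p1E := has_dim_uniq Xp1 Xp.
have q1E := has_dim_uniq ((has_dim_scale _ _ e0).1 Req1) Rq.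
pose Re := R `&` [set x | X (e * x)].
have XRe : X `&` scale_set e R = scale_set e Re.
  apply/seteqP; split=> [y [Xy [z Rz zy]]|_ [z [Rz Xz] <-]]; last by split=> //; exists z.
  by exists z => //; split=> //=; rewrite zy.
have Ret : has_dim K Re t by apply/(has_dim_scale _ _ e0); rewrite -XRe.
(* The induction is on [dim R], which drops strictly: [r] lies in [R] but not in [Re], as [e * r] is
   outside [X]. *)
have lt_tq : (t < q)%N.
  rewrite ltn_neqAle (has_dim_leq Ret Rq) ?andbT => [|z []//].
  apply/eqP => tq; rewrite tq in Ret.
  have ReR : Re = R by apply: has_dim_eq Ret Rq _ => z [].
  by move: Rr; rewrite -ReR => -[].
have sXR : is_subspace K [set u + v | u in X & v in scale_set e R].
  exact: subspace_add.
have sRe' : is_subspace K Re by apply: subspaceI => //; apply: subspace_mul_preimage.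
have [||x y||X' [R' [p' [q' [[sX' sR' X'A R'Re] X'R']]]]] :=
  IHk t s _ _ _ sXR sRe' _ _ XReS Ret.
- by rewrite -ltnS (leq_trans _ ltq).
- by move=> _ [u Xu [v Rv <-]]; apply: (subspaceD sA); [apply: XA|apply: ReA].
(* [(u + e * v) * y = u * y + (e * y) * v], where [e * y] is in [X] by the choice of [Re]; both
   terms lie in [XR]. *)
- case=> u Xu [_ [v Rv <-] <-] [Ry /= Xy].
  rewrite mulrDl mulrAC; apply: (subspaceD sA); first exact: XR.
  exact: XR.
- by rewrite st p1E q1E.
by exists X', R', p', q'; split=> //; split=> // z /R'Re[].
Qed.

(** * From an unmatched basis to a product contained in [A] *)

Lemma unmatched_product A B n (a : 'I_n -> L) :
  has_dim K B n -> is_subspace K A -> is_subspace K B -> is_basis K A a ->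
  ~ (exists b, is_basis K B b /\ basis_matched K A B a b) ->
  exists X R p q, [/\ is_subspace K X, is_subspace K R, X `<=` A & R `<=` B] /\
    [/\ forall x r, X x -> R r -> A (x * r), has_dim K X p, has_dim K R q &
      (n < p + q)%N].
Proof.
move=> Bn sA sB aA nm; have [b0 /is_basisP[b0i b0B]] := Bn.
(* [E i] is [a_i^-1 A :&: B] in coordinates with respect to [b0]. *)
have /choice[E EA] : forall i, exists U : {vspace 'rV[F]_n},
    forall v, v \in U <-> A (a i * comb iota b0 v).
  by move=> i; apply: (subspace_preimage b0 (subspace_mul_preimage (a i) sA)).
have a_neq0 i : a i != 0 by case: aA => ai _; apply: lin_indep_neq0 ai.
have dim_rV : \dim {:'rV[F]_n} = n by rewrite dimvf /dim /= mul1n.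
have [rE|] := boolP (rado E).
  have [b bE] := rado_transversal dim_rV rE.
  case: nm; exists (comb iota b0 \o b).
  (* A vanishing combination lies in every [E i], so the transversal property kills all its
     coefficients. *)
  have bi : injective (comb iota (comb iota b0 \o b)).
    apply/comb_inj => v; rewrite comb_comb => /(comb_inj _ b0).2-/(_ b0i) v0.
    by apply/rowP => i; rewrite [RHS]mxE; apply: (bE (v 0) i); rewrite v0 mem0v.
  have bB : range (comb iota (comb iota b0 \o b)) = B.
    apply: (has_dim_eq (iota := iota) (n := n)) => //.
      by exists (comb iota b0 \o b); apply/is_basisP.
    by rewrite -b0B => _ [v _ <-]; rewrite comb_comb; eexists.
  split; first exact/is_basisP.
  move=> i x [[y Ay yx]]; rewrite -bB => -[v _ vx].
  have : \sum_j v 0 j *: b j \in E i.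
    by apply/EA; rewrite -comb_comb vx -yx mulVKf.
  move/bE => vi; rewrite -vx; apply: comb_span => j /=.
  by apply: contra_neq => ->.
move=> /forallPn[J]; rewrite -ltnNge => ltJ.
(* Coordinates, with respect to [a], of the span of the [a_i] with [i] in [J]. *)
pose U : {vspace 'rV[F]_n} := <<[seq (delta_mx 0 j : 'rV[F]_n)%R | j <- enum J]>>%VS.
exists (comb iota a @` [set` U]), (comb iota b0 @` [set` (\bigcap_(i in J) E i)%VS]).
exists (\dim U), (\dim (\bigcap_(i in J) E i)).
have /is_basisP[ai aA'] := aA.
have dU : (#|J| <= \dim U)%N.
  (* The lower bound on [\dim U] follows from [U + U'] being everything, with at most [#|~: J|]
     generators for [U']. *)
  pose U' : {vspace 'rV[F]_n} :=
    <<[seq (delta_mx 0 j : 'rV[F]_n)%R | j <- enum (~: J)%SET]>>%VS.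
  have UU' : (fullv <= U + U')%VS.
    apply/subvP => v _; rewrite [v]row_sum_delta; apply: memv_suml => i _; apply: memvZ.
    have [iJ|iJ] := boolP (i \in J).
      by apply: (subvP (addvSl _ _)); apply/memv_span/map_f; rewrite mem_enum.
    by apply: (subvP (addvSr _ _)); apply/memv_span/map_f; rewrite mem_enum inE.
  have := dimvS UU'; rewrite dim_rV => /leq_trans/(_ (dimv_add_leqif _ _)).
  have dU' : (\dim U' <= #|~: J|)%N.
    by rewrite (leq_trans (dim_span _)) // size_map -cardE.
  move/leq_trans/(_ (leq_add (leqnn _) dU')).
  by have := cardsC J; rewrite card_ord => {1}<-; rewrite leq_add2r.
split; [split|split].
- exact: subspace_image.
- exact: subspace_image.
- by rewrite -aA' => _ [v _ <-]; exists v.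
- by rewrite -b0B => _ [v _ <-]; exists v.
- move=> _ _ [u uU <-] [v vE <-]; rewrite mulrC.
  (* For a fixed second factor, the first factors with product in [A] form a subspace, so checking
     the generators [a_j] suffices. *)
  have [Ur UrA] := subspace_preimage a (subspace_mul_preimage (comb iota b0 v) sA).
  suff /subvP/(_ u uU)/UrA : (U <= Ur)%VS by [].
  apply/span_subvP => _ /mapP[j jJ ->]; apply/UrA => /=.
  rewrite comb_delta mulrC; apply/EA.
  rewrite mem_enum in jJ.
  exact: (subvP (bigcapv_inf j jJ (subvv _)) _ vE).
- exact: has_dim_inj_image.
- exact: has_dim_inj_image.
- by apply: leq_trans ltJ _; rewrite addnC leq_add2r.
Qed.

(** * Stable subspaces as vector spaces over [adjoin K R] *)

(** Closure under inverses comes from finite dimension: for [y != 0] in the stabilizer, [yS] is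
    contained in [S] and has the same dimension, so [yS = S]. *)
Lemma stabilizer_subfield S d : is_subspace K S -> has_dim K S d ->
  is_subfield [set x | forall s, S s -> S (x * s)].
Proof.
move=> sS Sd; apply: is_subfieldP => [s|x y Px Py s Ss|x y Px Py s Ss] /=.
- by rewrite mul1r.
- by rewrite mulrBl; exact: (subspaceB sS (Px _ Ss) (Py _ Ss)).
have [->|y0] := eqVneq y 0; first by rewrite invr0 mulr0 mul0r; case: sS.
have yS : scale_set y S = S.
  apply: (has_dim_eq ((has_dim_scale _ _ y0).2 Sd) Sd).
  by move=> _ [z Sz <-]; apply: Py.
by move: Ss; rewrite -{1}yS => -[z Sz <-]; rewrite mulrA divfK //; apply: Px.
Qed.

(** The products [a_i e_j] form a basis. Pairs of indices are flattened by [mxvec_index]: row [i] of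
    [vec_mx v] holds the [K]-coordinates of the coefficient of [a_i]. *)
Lemma has_dim_tower (G : fieldType) (iotaG : {rmorphism G -> L}) S m d :
  has_dim (range iotaG) S m -> has_dim K (range iotaG) d -> has_dim K S (m * d).
Proof.
move=> [a /is_basisP[ai aS]] [e /is_basisP[ei eG]].
have [dec decK encK] := curry_mxvec_bij m d.
pose w k := a (dec k).1 * e (dec k).2; exists w.
have wE v : comb iota w v = \sum_i comb iota e (row i (vec_mx v)) * a i.
  rewrite {1}/comb (reindex (uncurry (@mxvec_index m d))) /=; last first.
    by exists dec => [ij _|k _]; [apply: decK|apply: encK].
  transitivity (\sum_i \sum_j iota (v 0 (mxvec_index i j)) * (a i * e j)).
    rewrite pair_bigA; apply: eq_bigr => -[i j] _ /=.
    by rewrite /w (decK (i, j)).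
  apply: eq_bigr => i _; rewrite mulr_suml; apply: eq_bigr => j _.
  by rewrite !mxE mulrAC mulrA.
apply/is_basisP; split.
  apply/comb_inj => v; rewrite wE => v0.
  have /choice[g gE] : forall i, exists g, iotaG g = comb iota e (row i (vec_mx v)).
    move=> i; have [g _ <-] : range iotaG (comb iota e (row i (vec_mx v))).
      by rewrite -eG; eexists.
    by exists g.
  have g0 : \row_i g i = 0.
    apply: ((comb_inj iotaG a).2 ai); rewrite -[RHS]v0.
    by apply: eq_bigr => i _; rewrite mxE gE.
  apply: (can_inj vec_mxK); apply/row_matrixP => i.
  rewrite linear0 row0; apply: ((comb_inj iota e).2 ei); rewrite -gE.
  by move/rowP/(_ i): g0; rewrite !mxE => ->; rewrite rmorph0.
have sS : is_subspace (range iotaG) S by rewrite -aS; apply: subspace_range.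
apply/seteqP; split=> [_ [v _ <-]|x].
  rewrite wE; apply: (subspace_sum _ sS) => i _.
  have : range (comb iota e) (comb iota e (row i (vec_mx v))).
    by exists (row i (vec_mx v)).
  rewrite eG => -[g _ <-]; apply: (subspaceZ _ sS); rewrite -aS.
  by exists (delta_mx 0 i); rewrite ?comb_delta.
rewrite -aS => -[v _ <-].
have /choice[u uE] : forall i, exists u, comb iota e u = iotaG (v 0 i).
  move=> i; have : range iotaG (iotaG (v 0 i)) by exists (v 0 i).
  by rewrite -eG => -[u _ <-]; exists u.
exists (mxvec (\matrix_i u i)) => //; rewrite wE.
by apply: eq_bigr => i _; rewrite mxvecK rowK uE.
Qed.

Lemma adjoin_decomposition R S d : is_subspace K S -> has_dim K S d -> (0 < d)%N ->
  (forall x r, S x -> R r -> S (x * r)) ->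
  exists (m : nat) (a : 'I_m -> L),
    (forall i, S (a i)) /\
    is_direct_sum S (fun i => scale_set (a i) (adjoin K R)) /\
    has_dim (adjoin K R) S m /\
    exists dS dKR : nat,
      [/\ has_dim K S dS, has_dim K (adjoin K R) dKR & dS = (m * dKR)%N].
Proof.
move=> sS Sd d_gt0 SR.
have ES x s : adjoin K R x -> S s -> S (x * s).
  (* The stabilizer of [S] is a subfield containing [K] and [R], hence [adjoin K R]. *)
  move=> Ex; apply: (Ex [set y | forall z, S z -> S (y * z)]).
  split; first exact: stabilizer_subfield Sd.
  move=> y [[c _ <-]|Ry] z Sz; first exact: subspaceZ.
  by rewrite mulrC; apply: SR.
have KE : K `<=` adjoin K R by move=> x Kx M [_ KRM]; apply: KRM; left.
have [G [iotaG GE]] := subfield_range (subfield_adjoin K R).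
rewrite GE in ES KE *.
have sE : is_subspace K (range iotaG).
  split=> [|_ _ _ [c _ <-] [x _ <-] [y _ <-]]; first by exists 0; rewrite ?rmorph0.
  have [c' _ c'E] : range iotaG (iota c) by apply: KE; exists c.
  by exists (c' * x + y) => //; rewrite rmorphD rmorphM c'E.
have sSE : is_subspace (range iotaG) S.
  split=> [|c u v Ec Su Sv]; first by case: sS.
  by apply: (subspaceD sS) => //; apply: ES.
have [s [si sS']] := Sd.
(* A [K]-basis of [S] also spans [S] over the larger field. *)
have [m [a aS]] : exists m, has_dim (range iotaG) S m.
  have [m mS] := has_dim_span iotaG s; exists m; move: mS.
  rewrite (_ : Defs.span _ _ = S) //; apply/seteqP; split.
    by apply: span_sub => // _ [i _ <-]; rewrite -sS'; apply: sub_span; exists i.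
  rewrite -[X in X `<=` _]sS'; apply: span_sub; last exact: sub_span.
  have [h0 h] := subspace_span iotaG (range s).
  by split=> // c u v Kc; apply: h; apply: KE.
have Sa i : S (a i) by case: aS => _ <-; apply: sub_span; exists i.
(* Multiplication by a nonzero element of [S], available since [0 < d], embeds [adjoin K R] into
   [S]. *)
have [dE Ed] : exists dE, has_dim K (range iotaG) dE.
  have s0 : s (Ordinal d_gt0) != 0 by apply: lin_indep_neq0 si.
  have [|dE Ed] := has_dim_sub Sd (subspace_scale (s (Ordinal d_gt0)) sE).
    move=> _ [x Ex <-]; rewrite mulrC; apply: ES => //.
    by rewrite -sS'; apply: sub_span; eexists.
  by exists dE; apply/(has_dim_scale _ _ s0).
exists m, a; split=> //; split; last first.
  split; first by exists a.
  by exists (m * dE)%N, dE; split=> //; apply: has_dim_tower Ed; exists a.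
have /is_basisP[ai aS'] := aS; split.
  apply/seteqP; split=> [x|_ [x xW <-]].
    rewrite -aS' => -[v _ <-]; exists (fun i => iotaG (v 0 i) * a i) => //= i.
    by exists (iotaG (v 0 i)); [exists (v 0 i)|rewrite mulrC].
  apply: (subspace_sum _ sS) => i _; have [y Ey <-] := xW i.
  by rewrite mulrC; apply: ES.
move=> x xW x0 i.
have /choice[g gE] : forall i, exists g, a i * iotaG g = x i.
  by move=> j; have [_ [g _ <-] <-] := xW j; exists g.
have /rowP/(_ i) : \row_i g i = 0.
  apply: ((comb_inj iotaG a).2 ai); rewrite -[RHS]x0.
  by apply: eq_bigr => j _; rewrite mxE mulrC gE.
by rewrite !mxE -gE => ->; rewrite rmorph0 mulr0.
Qed.

(** * A stable subspace obstructs matching *)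

Definition cat_family p q (s : 'I_p -> L) (y : 'I_q -> L) (i : 'I_(p + q)) : L :=
  match split i with inl j => s j | inr k => y k end.

Lemma is_basis_cat S Y A p q (s : 'I_p -> L) (y : 'I_q -> L) :
  is_direct_sum2 A S Y -> is_basis K S s -> is_basis K Y y ->
  is_basis K A (cat_family s y).
Proof.
move=> [-> SY] /is_basisP[si sS] /is_basisP[yi yY].
set w := cat_family s y.
have wE v : comb iota w v = comb iota s (lsubmx v) + comb iota y (rsubmx v).
  rewrite /comb big_split_ord /=; congr (_ + _); apply: eq_bigr => i _.
    by rewrite /w /cat_family (unsplitK (inl i)) mxE.
  by rewrite /w /cat_family (unsplitK (inr i)) mxE.
apply/is_basisP; split.
  apply/comb_inj => v; rewrite wE => /eqP; rewrite addr_eq0 => /eqP vE.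
  have s0 : comb iota s (lsubmx v) = 0.
    have : (S `&` Y) (comb iota s (lsubmx v)).
      split; first by rewrite -sS; exists (lsubmx v).
      rewrite vE -sub0r -(comb0 iota y) -combB -yY.
      by exists (0 - rsubmx v).
    by rewrite SY.
  move: vE; rewrite s0 => /eqP; rewrite eq_sym oppr_eq0 => /eqP y0.
  rewrite -[v]hsubmxK ((comb_inj iota s).2 si _ s0) ((comb_inj iota y).2 yi _ y0).
  exact: row_mx0.
apply/seteqP; split=> [_ [v _ <-]|x [u]].
  exists (comb iota s (lsubmx v)); first by rewrite -sS; exists (lsubmx v).
  by exists (comb iota y (rsubmx v)); rewrite ?wE // -yY; exists (rsubmx v).
rewrite -sS -yY => -[u1 _ <-] [_ [u2 _ <-] <-]; exists (row_mx u1 u2) => //.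
by rewrite wE row_mxKl row_mxKr.
Qed.

Lemma stable_unmatchable A B n R S Y dS dY dR :
  R `<=` B -> (forall x r, S x -> R r -> S (x * r)) ->
  is_direct_sum2 A S Y -> has_dim K A n ->
  has_dim K S dS -> has_dim K Y dY -> has_dim K R dR -> (dY < dR)%N ->
  ~ matchable K A B n.
Proof.
move=> RB SR ASY An [s sS] [y yY] [r [ri rR]] lt_dY.
have aA := is_basis_cat ASY sS yY.
have nE : n = (dS + dY)%N by apply: has_dim_uniq An _; eexists; exact: aA.
rewrite {}nE => /(_ _ aA)[b [bB bm]].
have /is_basisP[bi bB'] := bB.
suff : (dR <= dY)%N by rewrite leqNgt lt_dY.
(* It suffices that [R] lies in the span of the last [dY] vectors of [b]. *)
apply: (lin_indep_leq (w := fun k => b (rshift dS k)) ri) => i.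
have Rri : R (r i) by rewrite -rR; apply: sub_span; exists i.
have := RB _ Rri; rewrite -bB' => -[v _ vr].
have v0 (j : 'I_dS) : v 0 (lshift dY j) = 0.
  have aE : cat_family s y (lshift dY j) = s j by rewrite /cat_family (unsplitK (inl j)).
  have sj0 : s j != 0 by case: sS => si _; apply: lin_indep_neq0 si.
  (* [s j * r i] is in [S], hence in [A]; so [r i] is in [(s j)^-1 A :&: B], and matching excludes
     the [j]-th vector of [b]. *)
  have : Defs.span K [set b k | k in [set k | k != lshift dY j]] (r i).
    apply: bm; split; last exact: RB.
    exists (s j * r i); last by rewrite aE mulKf.
    case: ASY => -> _; exists (s j * r i).
      by apply: SR => //; case: sS => _ <-; apply: sub_span; exists j.
    exists 0; rewrite ?addr0 //; case: yY => _ <-.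
    by case: (subspace_span iota (range y)).
  (* The span is the smallest subspace, so it is contained in the one where the [j]-th coordinate
     vanishes. *)
  move=> /(_ (comb iota b @` [set u : 'rV_(dS + dY) | u 0 (lshift dY j) = 0])).
  case=> [|u /= u0]; last by rewrite -vr => /bi <-.
  split; last first.
    move=> _ [k /= kj <-]; exists (delta_mx 0 k); last exact: comb_delta.
    by rewrite /= mxE eq_sym (negPf kj) andbF.
  split; first by exists 0; rewrite ?comb0 //= mxE.
  move=> _ _ _ [c _ <-] [u1 /= u10 <-] [u2 /= u20 <-].
  by exists (c *: u1 + u2); rewrite ?combP //= !mxE u10 u20 mulr0 addr0.
exists (rsubmx v) => //; rewrite -vr /comb big_split_ord /=.
rewrite [X in _ = X + _]big1 ?add0r => [|j _].
  by apply: eq_bigr => k _; rewrite mxE.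
by rewrite v0 rmorph0 mul0r.
Qed.

End Matching.

(** * Characterization of unmatchable pairs *)

Theorem theorem3p3 (L : fieldType) (K A B : set L) (n : nat)
    (K_subfield : is_subfield K) (K_proper : K `<` [set: L])
    (n_gt0 : (0 < n)%N)
    (A_subspace : is_subspace K A) (A_dim : has_dim K A n)
    (B_subspace : is_subspace K B) (B_dim : has_dim K B n) :
  ~ matchable K A B n <->
  exists R S Y Z : set L,
    [/\ is_subspace K R, R `<=` B & R <> [set 0]] /\
    [/\ is_subspace K S, is_subspace K Y & is_subspace K Z] /\
    is_direct_sum2 A S Y /\
    is_direct_sum2 B R Z /\
    (exists dY dR : nat,
      [/\ has_dim K Y dY, has_dim K R dR & (dY < dR)%N]) /\
    exists (m : nat) (a : 'I_m -> L),
      (forall i, S (a i)) /\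
      is_direct_sum S (fun i => scale_set (a i) (adjoin K R)) /\
      has_dim (adjoin K R) S m /\
      exists dS dKR : nat,
        [/\ has_dim K S dS, has_dim K (adjoin K R) dKR & dS = (m * dKR)%N].
Proof.
have [F [iota KE]] := subfield_range K_subfield.
rewrite KE in A_subspace A_dim B_subspace B_dim *.
split.
  case/existsNP => a /not_implyP[aA nm].
  have [X [R0 [p0 [q0 [[sX sR0 XA R0B] [XR0 Xp0 R0q0 lt_n0]]]]]] :=
    unmatched_product B_dim A_subspace B_subspace aA nm.
  have [S [R [p [q [[sS sR SA RR0] [SR Sp Rq lt_n]]]]]] :=
    dyson_transform A_dim A_subspace sX sR0 XA XR0 Xp0 R0q0 lt_n0.
  have RB : R `<=` B by move=> x /RR0/R0B.
  (* Combined with [n < p + q], these bounds give [0 < q], so [R] is nonzero, and [0 < p], so [S] is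
     nonzero; moreover [dim Y = n - p < q]. *)
  have le_pn := has_dim_leq Sp A_dim SA; have le_qn := has_dim_leq Rq B_dim RB.
  have [Y [sY ASY Yd]] := complement A_dim sS SA Sp.
  have [Z [sZ BRZ _]] := complement B_dim sR RB Rq.
  exists R, S, Y, Z; split; [split=> // R0E|do 3!split=> //; split].
  - have [r [ri rR]] := Rq; have q_gt0 : (0 < q)%N by lia.
    have := lin_indep_neq0 (Ordinal q_gt0) ri; rewrite (_ : r _ = 0) ?eqxx //.
    have : R (r (Ordinal q_gt0)) by rewrite -rR; apply: sub_span; eexists.
    by rewrite R0E.
  - by exists (n - p)%N, q; split=> //; lia.
  - by apply: adjoin_decomposition SR; [|exact: Sp|lia].
move=> [R [S [Y [Z [[_ RB _] [_ [ASY [_ [[dY [dR [Yd Rd lt_d]]] decS]]]]]]]]].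
have [m [a [_ [[SE _] [_ [dS [_ [Sd _ _]]]]]]]] := decS.
apply: (stable_unmatchable RB _ ASY A_dim Sd Yd Rd lt_d) => x r.
(* Each summand [a_i K(R)] is stable under multiplication by [R], hence so is [S]. *)
rewrite SE => -[y yE <-] Rr; exists (fun i => y i * r); last by rewrite mulr_suml.
move=> i; have [z Ez <-] := yE i; exists (z * r); last by rewrite mulrA.
apply: (subfieldM (subfield_adjoin _ _) Ez).
by move=> M [_ KRM]; apply: KRM; right.
Qed.
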